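(* Let $\Gamma$ be a finite, simple, connected bipartite graph of diameter $3$ with bipartition sets $X$ and $Y$. Then precisely one of the following holds: (i) $\Gamma$ is highly distance-balanced; (ii) $\Gamma$ is $2$-distance-balanced but neither $1$-distance-balanced nor $3$-distance-balanced; (iii) $\Gamma$ is $3$-distance-balanced but neither $1$-distance-balanced nor $2$-distance-balanced; (iv) $\Gamma$ is not $\ell$-distance-balanced for any $1 \le \ell \le 3$.
   Context: For vertices $u,v$, $W_{uv} = \{w \mid d(u,w) < d(v,w)\}$. For a positive integer $\ell$, a connected graph of diameter at least $\ell$ is $\ell$-distance-balanced if $|W_{uv}| = |W_{vu}|$ for all $u,v$ with $d(u,v)=\ell$. A connected graph of diameter $D$ is highly distance-balanced if it is $\ell$-distance-balanced for every $1 \le \ell \le D$. *)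

(* Defs.v *)
From mathcomp Require Import all_boot.

Set Implicit Arguments.
Unset Strict Implicit.
Unset Printing Implicit Defensive.

Section Graphs.

Variables (T : finType) (e : rel T).

Definition simple_graph : Prop := symmetric e /\ irreflexive e.

Definition graph_connected : Prop := forall u v : T, connect e u v.

Definition has_walk (u v : T) (n : nat) : bool :=
  [exists p : n.-tuple T, path e u p && (last u p == v)].

(* Least length of a walk from u to v; a shortest walk has no repeated vertex,
   so it suffices to search below #|T|.  The value is #|T| when v cannot be
   reached from u. *)
Definition dist (u v : T) : nat := find (has_walk u v) (iota 0 #|T|).

Definition diameter : nat := \max_(u : T) \max_(v : T) dist u v.

Definition W (u v : T) : {set T} := [set w | dist u w < dist v w].

Definition distance_balanced (l : nat) : Prop :=
  [/\ 0 < l, graph_connected, l <= diameter &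
      forall u v : T, dist u v = l -> #|W u v| = #|W v u|].

Definition highly_distance_balanced : Prop :=
  graph_connected /\
  forall l : nat, 1 <= l <= diameter -> distance_balanced l.

Definition bipartition (X Y : {set T}) : Prop :=
  [/\ X :|: Y = [set: T], [disjoint X & Y] &
      forall u v : T, e u v ->
        (u \in X) && (v \in Y) || (u \in Y) && (v \in X)].

End Graphs.

Definition precisely_one_of_four (A B C D : Prop) : Prop :=
  [\/ A, B, C | D] /\
  (~ (A /\ B) /\ ~ (A /\ C) /\ ~ (A /\ D) /\
   ~ (B /\ C) /\ ~ (B /\ D) /\ ~ (C /\ D)).

(* Main.v *)
(* In a bipartite graph of diameter 3 the distance between two vertices is
   determined by whether they lie in the same colour class, are adjacent and
   are equal.  Computing W u v from this shows that |W u v| = |W v u| holds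
   exactly when h u = h v, where h u is the size of the colour class of u plus
   twice the degree of u.  So l-distance-balancedness says that h is constant
   on pairs at distance l.  If l = 1, connectedness makes h constant.  If both
   l = 2 and l = 3 are balanced, then h is constant on each colour class, and a
   pair at distance 3 links the two classes, so h is again constant. *)

Require Import Defs.
From mathcomp Require Import all_boot zify.

Set Implicit Arguments.
Unset Strict Implicit.
Unset Printing Implicit Defensive.

(** * Walks, distance and diameter *)

Section Distance.

Variables (T : finType) (e : rel T).

Lemma has_walkP (u v : T) (n : nat) :
  reflect (exists p, [/\ size p = n, path e u p & last u p = v])
          (has_walk e u v n).
Proof.
apply: (iffP existsP) => [[p /andP[ep /eqP <-]]|[p [sz_p ep lp]]].
  by exists p; rewrite size_tuple.
have sz_pP : size p == n by apply/eqP.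
by exists (Tuple sz_pP); rewrite /= ep lp eqxx.
Qed.

Lemma dist_le_walk (u v : T) (n : nat) : has_walk e u v n -> dist e u v <= n.
Proof.
move=> uv_n; rewrite /dist leqNgt; apply/negP => lt_n.
have lt_nT : n < #|T|.
  by apply: leq_trans lt_n _; rewrite -[leqRHS](size_iota 0) find_size.
by have := before_find 0 lt_n; rewrite nth_iota // uv_n.
Qed.

(** A path without repeated vertices has length below [#|T|], so the search defining [dist] succeeds
    and its default value is not reached. *)
Lemma connect_walk_dist (u v : T) :
  connect e u v -> has_walk e u v (dist e u v).
Proof.
case/connectP=> p0 ep0 ->; case: (shortenP ep0) => p ep uniq_p _ {p0 ep0}.
have has_uv : has (has_walk e u (last u p)) (iota 0 #|T|).
  apply/hasP; exists (size p); last by apply/has_walkP; exists p.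
  rewrite mem_iota /=; have := card_uniqP uniq_p => /= <-.
  exact: max_card.
have := nth_find 0 has_uv; rewrite nth_iota //.
by rewrite -[ltnRHS](size_iota 0) -has_find.
Qed.

Lemma dist_le_diameter (u v : T) : dist e u v <= diameter e.
Proof.
apply: leq_trans (leq_bigmax u).
exact: (leq_bigmax (F := fun v => dist e u v)).
Qed.

Lemma diameter_attained :
  0 < diameter e -> exists u v, dist e u v = diameter e.
Proof.
(* For empty [T] the maximum would be 0, against positivity. *)
move=> d_gt0; case: (pickP T) => [x _|T0]; last first.
  by move: d_gt0; rewrite /diameter big_pred0.
have T_gt0 : 0 < #|T| by apply/card_gt0P; exists x.
rewrite /diameter; have [u ->] := eq_bigmax (fun u => \max_v dist e u v) T_gt0.
by have [v ->] := eq_bigmax (dist e u) T_gt0; exists u, v.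
Qed.

Hypothesis e_connected : graph_connected e.

Lemma dist_eq0 (u v : T) : (dist e u v == 0) = (u == v).
Proof.
apply/eqP/eqP => [d0|<-].
  have := connect_walk_dist (e_connected u v).
  by rewrite d0 => /has_walkP[[|x p] []].
by apply/eqP; rewrite -leqn0 dist_le_walk //; apply/has_walkP; exists [::].
Qed.

Lemma dist_eq1 (u v : T) : u != v -> (dist e u v == 1) = e u v.
Proof.
move=> neq_uv; apply/eqP/idP => [d1|e_uv].
  have := connect_walk_dist (e_connected u v).
  by rewrite d1 => /has_walkP[[|x [|y p]] []] //= _ /andP[e_ux _] <-.
apply/eqP; rewrite eqn_leq lt0n dist_eq0 neq_uv andbT dist_le_walk //.
by apply/has_walkP; exists [:: v]; rewrite /= e_uv.
Qed.

End Distance.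

(** * Distances from colours *)

Section BipartiteDiameter3.

Variables (T : finType) (e : rel T) (c : pred T).
Hypothesis e_sym : symmetric e.
Hypothesis e_connected : graph_connected e.
Hypothesis e_diameter : diameter e = 3.
Hypothesis e_color : forall u v, e u v -> c v = ~~ c u.

Lemma walk_color (u v : T) (n : nat) :
  has_walk e u v n -> c v = c u (+) odd n.
Proof.
case/has_walkP=> p [<- + <-] {n v}.
elim: p u => [u _|x p IHp u /= /andP[/e_color cx /IHp ->]].
  by rewrite addbF.
by rewrite cx addNb addbN.
Qed.

Lemma dist_color (u v : T) : odd (dist e u v) = c u (+) c v.
Proof. by rewrite (walk_color (connect_walk_dist (e_connected u v))) addKb. Qed.

(** The distance is even and at most 3, hence 0 or 2. *)
Lemma dist_same_color (u v : T) : c u = c v -> dist e u v = (u != v).*2.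
Proof.
move=> cuv; have := dist_color u v; rewrite cuv addbb.
have := dist_eq0 e_connected u v; have := dist_le_diameter e u v.
by rewrite e_diameter; case: (dist e u v) => [|[|[|[|?]]]] //= _; case: (u == v).
Qed.

Lemma dist_diff_color (u v : T) :
  c u != c v -> dist e u v = if e u v then 1 else 3.
Proof.
move=> cuv; have neq_uv : u != v by apply: contraNneq cuv => ->.
have := dist_color u v; rewrite -negb_eqb cuv.
have := dist_eq1 e_connected neq_uv; have := dist_le_diameter e u v.
by rewrite e_diameter; case: (dist e u v) => [|[|[|[|?]]]] //= _ <-.
Qed.

(** * The sets [W] and their sizes *)

Definition nbhd (u : T) : {set T} := [set w | e u w].
Definition color_class (u : T) : {set T} := [set w | c w == c u].
Definition height (u : T) : nat := #|color_class u| + #|nbhd u|.*2.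

Lemma W_same_color (u v : T) :
  u != v -> c u = c v -> W e u v = u |: (nbhd u :\: nbhd v).
Proof.
move=> neq_uv cuv; apply/setP=> w; rewrite !inE.
have [cuw|cuw] := eqVneq (c u) (c w).
  rewrite !dist_same_color -?cuv // [w == u]eq_sym.
  have /negbTE-> : ~~ e u w by apply/negP=> /e_color; rewrite -cuw; case: (c u).
  rewrite andbF orbF; have [<-|_] := eqVneq u w; first by rewrite eq_sym neq_uv.
  by case: eqP.
have /negbTE-> : w != u by apply: contraNneq cuw => ->.
by rewrite !dist_diff_color -?cuv //; case: (e u w); case: (e v w).
Qed.

(** The right-hand side is symmetric in [u] and [v], so swapping them compares [W e u v] with
    [W e v u] through the degrees alone. *)
Lemma card_W_same_color (u v : T) : u != v -> c u = c v ->
  #|W e u v| + #|nbhd v| = (#|nbhd u :|: nbhd v|).+1.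
Proof.
move=> neq_uv cuv; rewrite W_same_color // cardsU1.
have -> : u \notin nbhd u :\: nbhd v.
  by rewrite !inE negb_and orbC; apply/orP; left;
     apply/negP=> /e_color; case: (c u).
by rewrite cardsU; have := cardsID (nbhd v) (nbhd u); lia.
Qed.

(** In the class of [u], distances are 0 or 2 from [u] and 1 or 3 from [v]; in the class of [v] it
    is the reverse. If [u] and [v] are adjacent, [A] wrongly omits [u] and contains [v]. *)
Lemma W_diff_color (u v : T) : c u != c v ->
  let A := nbhd u :|: (color_class u :\: nbhd v) in
  W e u v = if e u v then u |: (A :\ v) else A.
Proof.
move=> cuv /=; have vNu : v != u by apply: contraNneq cuv => ->.
apply/setP=> w; rewrite [in LHS]inE.
have [cuw|cuw] := eqVneq (c u) (c w).
  have wNv : w != v by apply: contraNneq cuv => <-; rewrite cuw.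
  have euw : e u w = false.
    by apply/negP=> /e_color; rewrite -cuw; case: (c u).
  rewrite (dist_same_color cuw) (@dist_diff_color v w); last first.
    by rewrite -cuw eq_sym.
  case euv: (e u v); rewrite !inE ?wNv euw cuw eqxx ?[w == u]eq_sym andbT /=.
    by case: (u == w); case: (e v w).
  have [<-|_] := eqVneq u w; last by case: (e v w).
  by rewrite e_sym euv.
have cvw : c v = c w by move: cuv cuw; case: (c u); case: (c v); case: (c w).
have wNu : w != u by apply: contraNneq cuw => ->.
rewrite (dist_diff_color cuw) (dist_same_color cvw).
case euv: (e u v); rewrite !inE ?(negbTE wNu) [c w == _]eq_sym (negbTE cuw);
  rewrite andbF orbF /= ?[w == v]eq_sym.
  by case: (v == w); case: (e u w).
by have [<-|_] := eqVneq v w; rewrite ?euv //; case: (e u w).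
Qed.

Lemma card_W_diff_color (u v : T) : c u != c v ->
  #|W e u v| + #|nbhd v| = #|color_class u| + #|nbhd u|.
Proof.
move=> cuv; rewrite W_diff_color //.
set A := nbhd u :|: _.
have cardA : #|A| + #|nbhd v| = #|color_class u| + #|nbhd u|.
  have sub : nbhd v \subset color_class u.
    apply/subsetP=> w; rewrite !inE => /e_color ->.
    by move: cuv; case: (c u); case: (c v).
  have dis : nbhd u :&: (color_class u :\: nbhd v) = set0.
    apply/setP=> w; rewrite !inE; apply/negP=> /and3P[/e_color-> _].
    by case: (c u).
  rewrite /A cardsU dis cards0 subn0 cardsD (setIidPr sub).
  by have := subset_leq_card sub; lia.
(* Trading [v] for [u] does not change the size of [A]. *)
case: ifP => // euv; rewrite cardsU1 (_ : u \notin A :\ v) -?cardA.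
  by have := cardsD1 v A; rewrite !inE euv /= => ->.
rewrite !inE eqxx (e_sym v) euv /= orbF.
by apply/nandP; right; apply/negP=> /e_color; case: (c u).
Qed.

(** By the two counts, [#|W e u v| - #|W e v u|] is the difference of the degrees for equal colours,
    where the class sizes cancel in [height], and the difference of the heights otherwise. *)
Lemma card_W_eq_height (u v : T) :
  (#|W e u v| == #|W e v u|) = (height u == height v).
Proof.
have [->|neq_uv] := eqVneq u v; first by rewrite !eqxx.
rewrite /height; have [cuv|cuv] := eqVneq (c u) (c v).
  have := card_W_same_color neq_uv cuv.
  rewrite eq_sym in neq_uv; have := card_W_same_color neq_uv (esym cuv).
  by rewrite setUC (_ : color_class u = color_class v) /color_class ?cuv //; lia.
have := card_W_diff_color cuv; rewrite eq_sym in cuv.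
by have := card_W_diff_color cuv; lia.
Qed.

(** * Balance as constancy of the height *)

Definition height_balanced (l : nat) : bool :=
  [forall u, forall v, (dist e u v == l) ==> (height u == height v)].

Lemma height_balancedP (l : nat) :
  reflect (forall u v, dist e u v = l -> height u = height v)
          (height_balanced l).
Proof.
apply: (iffP 'forall_forallP) => h u v; last by apply/implyP=> /eqP/h->.
by move=> /eqP uvl; apply/eqP; apply: implyP (h u v) uvl.
Qed.

Lemma distance_balancedP (l : nat) : 0 < l <= 3 ->
  reflect (distance_balanced e l) (height_balanced l).
Proof.
case/andP=> l_gt0 l_le3; apply: (iffP (height_balancedP l)) => [h|[_ _ _ h]].
  split=> [//|//||u v /h/eqP]; first by rewrite e_diameter.
  by rewrite -card_W_eq_height => /eqP.
by move=> u v /h/eqP; rewrite card_W_eq_height => /eqP.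
Qed.

Lemma height_const_balanced (l : nat) :
  (forall u v, height u = height v) -> height_balanced l.
Proof. by move=> h; apply/height_balancedP. Qed.

Lemma height_const_of_balanced1 :
  height_balanced 1 -> forall u v, height u = height v.
Proof.
move/height_balancedP=> h u v.
(* Having the height of [u] propagates along edges, hence to the whole connected graph. *)
have cl : closed e [pred w | height u == height w].
  move=> x y exy; rewrite !inE (h x y) //; apply/eqP; rewrite dist_eq1 //.
  by apply/eqP=> eq_xy; move: (e_color exy); rewrite eq_xy; case: (c y).
have := closed_connect cl (e_connected u v).
by rewrite !inE eqxx => /esym/eqP.
Qed.

Lemma height_const_of_balanced23 :
  height_balanced 2 -> height_balanced 3 -> forall u v, height u = height v.
Proof.
move=> /height_balancedP h2 /height_balancedP h3.
have same u v : c u = c v -> height u = height v.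
  have [->//|neq_uv] := eqVneq u v.
  by move=> cuv; apply: h2; rewrite dist_same_color ?neq_uv.
have [|x [y]] := @diameter_attained _ e; rewrite e_diameter // => dxy.
have hxy := h3 _ _ dxy.
have cxy : c y = ~~ c x.
  by have := dist_color x y; rewrite dxy; case: (c x); case: (c y).
(* Every vertex has the colour of [x] or of [y], and these two have equal height. *)
suff hx u : height u = height x by move=> u v; rewrite !hx.
have [/same//|cux] := eqVneq (c u) (c x).
by rewrite hxy; apply: same; rewrite cxy; move: cux; case: (c u); case: (c x).
Qed.

End BipartiteDiameter3.

Theorem theorem3p8 (T : finType) (e : rel T) (X Y : {set T})
    (e_simple : simple_graph e) (e_connected : graph_connected e)
    (XY_bipartition : bipartition e X Y) (e_diameter : diameter e = 3) :
  precisely_one_of_four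
    (highly_distance_balanced e)
    (distance_balanced e 2 /\
       ~ distance_balanced e 1 /\ ~ distance_balanced e 3)
    (distance_balanced e 3 /\
       ~ distance_balanced e 1 /\ ~ distance_balanced e 2)
    (forall l : nat, 1 <= l <= 3 -> ~ distance_balanced e l).
Proof.
have [e_sym _] := e_simple; have [_ disXY eXY] := XY_bipartition.
pose c := mem X.
have e_color u v : e u v -> c v = ~~ c u.
  rewrite /c /= => /eXY/orP[]/andP[].
    by move=> -> /(disjointFl disXY).
  by move=> /(disjointFl disXY)-> ->.
have balP := distance_balancedP e_sym e_connected e_diameter e_color.
pose b := height_balanced e c.
have allb l : (forall u v, height e c u = height e c v) -> b l.
  exact: height_const_balanced.
have b1 l : b 1 -> b l.
  by move=> h; apply/allb/height_const_of_balanced1.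
have b23 : b 2 -> b 3 -> b 1.
  by move=> h2 h3; apply/allb/height_const_of_balanced23.
have hi : highly_distance_balanced e <-> b 1.
  split=> [[_ h]|h]; first by apply/balP => //; apply: h; rewrite e_diameter.
  by split=> // l; rewrite e_diameter => lP; apply/balP/b1.
have none : (forall l, 1 <= l <= 3 -> ~ distance_balanced e l) <->
            ~~ [|| b 1, b 2 | b 3].
  split=> [h|/norP[n1 /norP[n2 n3]] l lP].
    by apply/negP=> /or3P[] bl; [case: (h 1)|case: (h 2)|case: (h 3)] => //;
       apply/balP.
  move/(balP _ lP); apply/negP.
  by case: l lP => [|[|[|[|l]]]].
have bE l : 0 < l <= 3 -> distance_balanced e l <-> b l by move=> /balP/rwP.
have := (bE 1 isT, bE 2 isT, bE 3 isT) => -[[r1 r2] r3].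
move: (b1 2) (b1 3) b23 hi none r1 r2 r3; rewrite /precisely_one_of_four.
(* These give [tauto] the truth values of the coerced booleans. *)
have [tt ff] : true /\ ~ false by [].
(* Of the eight patterns, [b 1] forces the other two and [b 2] with [b 3] forces [b 1]. The four
   survivors are all true, only [b 2], only [b 3], and none, one for each alternative. *)
case: (b 1); case: (b 2); case: (b 3) => /= i2 i3 i23 hi none r1 r2 r3;
  split; try tauto.
- by apply: Or41; tauto.
- by apply: Or42; tauto.
- by apply: Or43; tauto.
- by apply: Or44; tauto.
Qed.
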